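(* If every sofic group with Kazhdan's Property (T) is residually finite, then there exists a word-hyperbolic group that is not residually finite.
   Context: For $n\ge1$, $S_n$ is the symmetric group on $n$ elements and $\#_{\rm fix}\pi$ is the number of fixed points of $\pi\in S_n$. A group $\Gamma$ is sofic if for every real $0<\varepsilon<1$ and every finite subset $F\subseteq\Gamma$ there exist a natural number $n\ge 1$ and a function $\phi:\Gamma\to S_n$ such that (a) $\#_{\rm fix}(\phi(e)\phi(f)\phi(ef)^{-1})\ge(1-\varepsilon)n$ for all $e,f\in F$; (b) $\phi(1)=1$; (c) $\#_{\rm fix}\phi(e)\le\varepsilon n$ for every $1\ne e\in F$. *)

(* Defs.v *)
From HB Require Import structures.
From mathcomp Require Import all_boot all_order all_algebra all_fingroup.
From mathcomp Require Import finmap complex.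
From mathcomp Require Import boolp reals topology normedtype.

Set Implicit Arguments.
Unset Strict Implicit.
Unset Printing Implicit Defensive.

Import Order.TTheory GRing.Theory Num.Theory.
Import numFieldNormedType.Exports.

Local Open Scope fset_scope.
Local Open Scope ring_scope.

Definition num_fix (n : nat) (s : 'S_n) : nat := #|[pred i | s i == i]|.

(* The product of 'S_n composes from left to right. With the other convention
   one gets the same notion, replacing phi by its pointwise inverse. *)
Definition sofic (R : realType) (G : groupType) : Prop :=
  forall (eps : R) (F : {fset G}), 0 < eps < 1 ->
  exists (n : nat) (phi : G -> 'S_n),
    [/\ (0 < n)%N,
        forall e f, e \in F -> f \in F ->
          (1 - eps) * n%:R <= (num_fix (phi e * phi f * (phi (e * f))^-1)%g)%:R,
        phi 1%g = 1%g
      & forall e, e \in F -> e != 1%g -> (num_fix (phi e))%:R <= eps * n%:R].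

Definition residually_finite (G : groupType) : Prop :=
  forall g : G, g != 1%g ->
  exists (Q : finGroupType) (f : {multiplicative G -> Q}), f g != 1%g.

(* Complex Hilbert spaces; R[i] is ordered by x <= y iff y - x is a
   nonnegative real, and norms take values in R[i]. *)
Record hilbert_space (R : realType) := HilbertSpace {
  hilbert_sort :> completeNormedModType R[i];
  hilbert_dot : {dot hilbert_sort for Num.conj};
  hilbert_normE : forall u : hilbert_sort, `|u| ^+ 2 = hilbert_dot u u }.

(* Unitarity: each operator preserves the inner product and is invertible
   because rep is an action. *)
Record unitary_rep (R : realType) (G : groupType) (H : hilbert_space R) :=
  UnitaryRep {
    rep_op :> G -> {linear H -> H};
    rep1 : forall v, rep_op 1%g v = v;
    repM : forall g h v, rep_op (g * h)%g v = rep_op g (rep_op h v);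
    rep_dot : forall g u v,
      hilbert_dot H (rep_op g u) (rep_op g v) = hilbert_dot H u v }.

Definition has_invariant_vector (R : realType) (G : groupType)
    (H : hilbert_space R) (pi : unitary_rep G H) : Prop :=
  exists2 v : H, v != 0 & forall g, pi g v = v.

Definition has_almost_invariant_vector (R : realType) (G : groupType)
    (H : hilbert_space R) (pi : unitary_rep G H) (K : {fset G}) (eps : R) :
    Prop :=
  exists2 v : H, v != 0 &
    forall g, g \in K -> `|pi g v - v| < (eps%:C)%C * `|v|.

(* Groups are discrete, so compact subsets are finite and every
   representation is strongly continuous. *)
Definition property_T (R : realType) (G : groupType) : Prop :=
  exists (K : {fset G}) (eps : R), 0 < eps /\
  forall (H : hilbert_space R) (pi : unitary_rep G H),
    has_almost_invariant_vector pi K eps -> has_invariant_vector pi.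

Definition word_over (G : groupType) (S : {fset G}) (w : seq G) : bool :=
  all [pred x | (x \in S) || (x^-1%g \in S)] w.

Definition word_of_size (G : groupType) (S : {fset G}) (g : G) (n : nat) :
    Prop :=
  exists w : seq G, [/\ word_over S w, size w = n & (\prod_(x <- w) x)%g = g].

Definition generates (G : groupType) (S : {fset G}) : Prop :=
  forall g : G, exists n, word_of_size S g n.

Lemma word_of_size_ex (G : groupType) (S : {fset G}) (g : G) :
  generates S -> exists n, `[< word_of_size S g n >].
Proof. by move=> /(_ g)[n gn]; exists n; apply/asboolP. Qed.

Definition word_length (G : groupType) (S : {fset G}) (genS : generates S)
    (g : G) : nat :=
  ex_minn (word_of_size_ex g genS).

Definition word_metric (R : realType) (G : groupType) (S : {fset G})
    (genS : generates S) (x y : G) : R :=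
  (word_length genS (x^-1 * y)%g)%:R.

Definition gromov_product (R : realType) (X : Type) (d : X -> X -> R)
    (w x y : X) : R :=
  (d x w + d y w - d x y) / 2.

Definition gromov_hyperbolic (R : realType) (X : Type) (d : X -> X -> R) :
    Prop :=
  exists2 delta : R, 0 <= delta & forall w x y z : X,
    Num.min (gromov_product d w x y) (gromov_product d w y z) - delta
      <= gromov_product d w x z.

Definition word_hyperbolic (R : realType) (G : groupType) : Prop :=
  exists (S : {fset G}) (genS : generates S),
    gromov_hyperbolic (@word_metric R G S genS).

(* Main.v *)
(* The hypothesis is refuted by a sofic group with property (T) that is not
   residually finite, in the spirit of Thom and of Ershov and Jaikin-Zapirin.

   Let p be prime and let G be generated by N elements of order p, p >= N^2,
   such that any two of them generate a group of class at most 2. In a unitary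
   representation let Q_i be the projection onto the complement of the vectors
   fixed by the i-th generator. In a Heisenberg group mod p the cosine of the
   angle between two such subspaces is at most p^(-1/2) <= 1/N, so that S, the
   sum of the Q_i, satisfies S^2 >= S / N. Gradient descent for <Sv, v> then
   converges geometrically from an almost invariant vector to a nonzero
   invariant one, and G has (T).

   For finite groups H_m marked by N elements, words modulo equality along a
   nonprincipal ultrafilter form a group which is locally embeddable into
   finite groups, hence sofic. Take H_m generated by elementary 3x3 block
   matrices e_12(1), e_23(1), e_31(t), e_31(t^T), e_31(E), with blocks of
   size m+1 over F_29, t the shift and E a matrix unit. In the limit there are
   u_i, v_j with [v_j, u_i] = 1 for i <> j and [v_i, u_i] = z <> 1
   independent of i. In a finite quotient two of the u_i coincide, which
   kills z. *)
Require Import Defs.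
From HB Require Import structures.
From mathcomp Require Import all_boot all_order all_algebra all_fingroup.
From mathcomp Require Import finmap complex ring lra.
From mathcomp Require Import boolp classical_sets reals topology normedtype.
From mathcomp Require Import sequences.

Set Implicit Arguments.
Unset Strict Implicit.
Unset Printing Implicit Defensive.

Import Order.TTheory GRing.Theory Num.Theory.
Import numFieldNormedType.Exports.

Local Open Scope classical_set_scope.
Local Open Scope ring_scope.

(** * Angles between orthogonal projections *)

Section RealInnerProduct.
Variables (R : realType) (H : hilbert_space R).
Implicit Types (u v w : H) (a : R).

Definition real_dot u v : R := complex.Re (hilbert_dot H u v).

Lemma real_dotDl u v w : real_dot (u + v) w = real_dot u w + real_dot v w.
Proof. by rewrite /real_dot linearDl raddfD. Qed.

Lemma real_dotC u v : real_dot u v = real_dot v u.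
Proof.
rewrite /real_dot (hermitian_subproof u v) expr0 mul1r.
have -> : Num.conj (hilbert_dot H v u) = (hilbert_dot H v u)^*%C by [].
by case: (hilbert_dot H v u).
Qed.

Lemma real_dotDr u v w : real_dot w (u + v) = real_dot w u + real_dot w v.
Proof. by rewrite real_dotC real_dotDl !(real_dotC w). Qed.

Lemma real_dotZl a u v : real_dot (a%:C%C *: u) v = a * real_dot u v.
Proof.
rewrite /real_dot linearZl_LR /=; case: (hilbert_dot H u v) => x y /=.
by rewrite mul0r subr0.
Qed.

Lemma real_dotZr a u v : real_dot u (a%:C%C *: v) = a * real_dot u v.
Proof. by rewrite real_dotC real_dotZl real_dotC. Qed.

Lemma real_dotNl u v : real_dot (- u) v = - real_dot u v.
Proof. by rewrite /real_dot linearNl raddfN. Qed.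

Lemma real_dotNr u v : real_dot u (- v) = - real_dot u v.
Proof. by rewrite real_dotC real_dotNl real_dotC. Qed.

Lemma real_dotBl u v w : real_dot (u - v) w = real_dot u w - real_dot v w.
Proof. by rewrite real_dotDl real_dotNl. Qed.

Lemma real_dotBr u v w : real_dot w (u - v) = real_dot w u - real_dot w v.
Proof. by rewrite real_dotDr real_dotNr. Qed.

Lemma real_dot0l u : real_dot 0 u = 0.
Proof. by rewrite /real_dot linear0l. Qed.

Lemma real_dot_suml I (r : seq I) (F : I -> H) u :
  real_dot (\sum_(i <- r) F i) u = \sum_(i <- r) real_dot (F i) u.
Proof.
elim: r => [|i r IHr]; first by rewrite !big_nil real_dot0l.
by rewrite !big_cons real_dotDl IHr.
Qed.

Lemma real_dot_sumr I (r : seq I) (F : I -> H) u :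
  real_dot u (\sum_(i <- r) F i) = \sum_(i <- r) real_dot u (F i).
Proof.
by rewrite real_dotC real_dot_suml; apply: eq_bigr => i _; rewrite real_dotC.
Qed.

Lemma sqr_norm_real_dot u : `|u| ^+ 2 = (real_dot u u)%:C%C.
Proof.
have := hilbert_normE u; rewrite /real_dot => <-.
by rewrite RRe_real// realX// normr_real.
Qed.

Lemma real_dot_ge0 u : 0 <= real_dot u u.
Proof. by rewrite -ler0c -sqr_norm_real_dot exprn_ge0. Qed.

Lemma norm_real_dot u : `|u| = (Num.sqrt (real_dot u u))%:C%C.
Proof.
apply/eqP; rewrite -(eqrXn2 (n := 2))// ?ler0c ?sqrtr_ge0//.
by rewrite sqr_norm_real_dot -rmorphXn /= sqr_sqrtr// real_dot_ge0.
Qed.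

Lemma norm_real_dot_le u a :
  0 <= a -> (`|u| <= a%:C%C) = (real_dot u u <= a ^+ 2).
Proof.
move=> a0; rewrite norm_real_dot lecR -(ler_sqr _ a0) ?nnegrE ?sqrtr_ge0//.
by rewrite sqr_sqrtr// real_dot_ge0.
Qed.

Lemma real_dot_le_half u v : real_dot u v <= (real_dot u u + real_dot v v) / 2.
Proof.
have := real_dot_ge0 (u - v).
by rewrite real_dotBl !real_dotBr (real_dotC v u) => ?; lra.
Qed.

Lemma real_dot_sum_le (I : finType) (F : I -> H) :
  real_dot (\sum_i F i) (\sum_i F i) <= #|I|%:R * \sum_i real_dot (F i) (F i).
Proof.
rewrite real_dot_suml.
apply: (@le_trans _ _ (\sum_i \sum_j
  (real_dot (F i) (F i) + real_dot (F j) (F j)) / 2)).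
  apply: ler_sum => i _; rewrite real_dot_sumr; apply: ler_sum => j _.
  exact: real_dot_le_half.
under eq_bigr => i _ do rewrite -mulr_suml big_split /= sumr_const.
rewrite -mulr_suml big_split /= sumr_const -sumrMnl.
under eq_bigr do rewrite -mulr_natl.
rewrite -mulr_sumr -mulr_natl; set S := \sum_i _. lra.
Qed.

Record orthogonal_projection (P : H -> H) : Prop := OrthogonalProjection {
  proj_sub : forall u v, P (u - v) = P u - P v;
  proj_id : forall u, P (P u) = P u;
  proj_dot : forall u v, real_dot (P u) v = real_dot u (P v) }.

Section Projection.
Variables (P : H -> H) (HP : orthogonal_projection P).

Lemma proj0 : P 0 = 0.
Proof. by have := proj_sub HP 0 0; rewrite !subrr. Qed.

Lemma proj_dot_id u : real_dot u (P u) = real_dot (P u) (P u).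
Proof. by rewrite (proj_dot HP) (proj_id HP). Qed.

Lemma proj_pythagoras u v :
  real_dot u v = real_dot (P u) (P v) + real_dot (u - P u) (v - P v).
Proof.
rewrite real_dotBl !real_dotBr (proj_dot HP u v) (proj_dot HP u (P v)).
by rewrite (proj_id HP); ring.
Qed.

Lemma sqr_sub_proj u :
  real_dot (u - P u) (u - P u) = real_dot u u - real_dot (P u) (P u).
Proof. by rewrite (proj_pythagoras u u); ring. Qed.

Lemma proj_compl : orthogonal_projection (fun u => u - P u).
Proof.
split=> [u v|u|u v].
- by rewrite (proj_sub HP) !opprD !opprK addrACA.
- by rewrite (proj_sub HP) (proj_id HP) subrr subr0.
- by rewrite real_dotBl real_dotBr (proj_dot HP).
Qed.

End Projection.

(** Passes from the ranges of P and P' to their complements Q = 1 - P and Q' = 1 - P': as quadratic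
    forms, QQ' + Q'Q >= -c (Q + Q'). These are the cross terms in the square of a sum of such Q. *)
Lemma proj_angle P P' (c : R) x :
  orthogonal_projection P -> orthogonal_projection P' -> 0 < c <= 1 ->
  real_dot (P' (P x)) (P' (P x)) <= c ^+ 2 * real_dot (P x) (P x) ->
  0 <= 2 * real_dot (x - P x) (x - P' x)
       + c * (real_dot (x - P x) (x - P x) + real_dot (x - P' x) (x - P' x)).
Proof.
move=> HP HP' /andP[c0 c1] le_c; rewrite !sqr_sub_proj//.
rewrite real_dotBl !real_dotBr (proj_dot_id HP') (real_dotC (P x) x).
rewrite (proj_dot_id HP).
(* With [A], [B], [D] as set below, [1 + c] times the goal is twice the squared norm of this vector
   plus (1 - c)(c (A + B) - 2 D), and [h2] makes the last factor nonnegative. *)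
have := real_dot_ge0 ((1 + c)%:C%C *: x - P x - P' x).
rewrite !(real_dotBl, real_dotBr, real_dotZl, real_dotZr).
rewrite (real_dotC _ x) (real_dotC _ x) (real_dotC (P' x) (P x)).
rewrite (proj_dot_id HP) (proj_dot_id HP').
have := real_dot_ge0 (P' (P x) - c%:C%C *: P' x).
rewrite !(real_dotBl, real_dotBr, real_dotZl, real_dotZr).
rewrite (real_dotC (P' x) (P' (P x))) (proj_dot HP' (P x) (P' x)).
rewrite (proj_id HP'); move: le_c.
set A := real_dot (P x) (P x); set B := real_dot (P' x) (P' x).
set D := real_dot (P x) (P' x); set X := real_dot x x.
set E := real_dot (P' (P x)) (P' (P x)) => le_c h1 h0.
have h2 : 2 * D <= c * (A + B).
  by rewrite -(ler_pM2l c0); nra.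
rewrite -(pmulr_rge0 _ (_ : 0 < 1 + c)); last lra.
have := mulr_ge0 (_ : 0 <= 1 - c) (_ : 0 <= c * (A + B) - 2 * D).
rewrite !subr_ge0 => /(_ c1 h2); lra.
Qed.

(** Z commutes with both projections, so the form splits along its range and its kernel. On the
    range the projections commute and the cross term is nonnegative; on the kernel [proj_angle]
    applies. *)
Lemma proj_angle_split P P' Z (c : R) v :
  orthogonal_projection P -> orthogonal_projection P' ->
  orthogonal_projection Z -> 0 < c <= 1 ->
  (forall u, Z (P u) = P (Z u)) -> (forall u, Z (P' u) = P' (Z u)) ->
  (forall u, Z u = u -> P (P' u) = P' (P u)) ->
  (forall u, Z u = 0 ->
    real_dot (P' (P u)) (P' (P u)) <= c ^+ 2 * real_dot (P u) (P u)) ->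
  0 <= 2 * real_dot (v - P v) (v - P' v)
       + c * (real_dot (v - P v) (v - P v) + real_dot (v - P' v) (v - P' v)).
Proof.
move=> HP HP' HZ c01 ZP ZP' comm small.
have [c0 c1] := andP c01.
set a := v - P v; set b := v - P' v.
have Za : Z a = Z v - P (Z v) by rewrite (proj_sub HZ) ZP.
have Zb : Z b = Z v - P' (Z v) by rewrite (proj_sub HZ) ZP'.
have Ya : a - Z a = (v - Z v) - P (v - Z v).
  by rewrite Za (proj_sub HP) /a !opprD !opprK addrACA.
have Yb : b - Z b = (v - Z v) - P' (v - Z v).
  by rewrite Zb (proj_sub HP') /b !opprD !opprK addrACA.
have := proj_angle HP HP' c01 (small (v - Z v) _).
rewrite (proj_sub HZ) (proj_id HZ) subrr => /(_ erefl).
rewrite -Ya -Yb !(proj_pythagoras HZ a) !(proj_pythagoras HZ b b).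
(* For commuting complements Q and Q', the product of Qw and Q'w is the squared norm of Q'Qw. *)
have Zab : 0 <= real_dot (Z a) (Z b).
  have PZ := comm (Z v) (proj_id HZ v).
  rewrite Za Zb; set w := Z v in PZ *.
  have QQ' : (w - P' w) - P (w - P' w) = (w - P w) - P' (w - P w).
    by rewrite (proj_sub HP) (proj_sub HP') PZ !opprD !opprK addrACA.
  rewrite -(proj_id (proj_compl HP) w) (proj_dot (proj_compl HP)) QQ'.
  rewrite (proj_dot_id (proj_compl HP')).
  exact: real_dot_ge0.
have := real_dot_ge0 (Z a); have := real_dot_ge0 (Z b).
have := mulr_ge0 (ltW c0) (real_dot_ge0 (Z a)).
have := mulr_ge0 (ltW c0) (real_dot_ge0 (Z b)).
lra.
Qed.

End RealInnerProduct.

(** * Unitary representations of groups of class two *)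

Section ClassTwo.
Local Open Scope group_scope.
Variables (G : groupType) (a b z : G).
Hypotheses (abz : a * b = b * a * z) (cza : commute z a) (czb : commute z b).

Lemma class_two_expg i j :
  a ^+ i * b ^+ j = b ^+ j * a ^+ i * z ^+ (i * j).
Proof.
have a_bX k : a * b ^+ k = b ^+ k * a * z ^+ k.
  elim: k => [|k IHk]; first by rewrite !expg0 mulg1 mul1g mulg1.
  rewrite [in LHS]expgS mulgA abz -(mulgA _ z) (commuteX k czb) mulgA.
  by rewrite -(mulgA b a) IHk !mulgA -(mulgA _ (z ^+ k) z) -expgSr -expgS.
elim: i => [|i IHi]; first by rewrite mul0n !expg0 mulg1 mul1g mulg1.
rewrite expgS -mulgA IHi !mulgA a_bX -!mulgA mulSn expgnDr; congr (_ * (_ * _)).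
by rewrite !mulgA; congr (_ * _); apply: commuteX2.
Qed.

(** Ensures that averaging over the powers of the commutator is a projection as well. *)
Lemma class_two_expg1 n : a ^+ n = 1 -> z ^+ n = 1.
Proof.
move=> an; have := class_two_expg n 1; rewrite an mul1g mulg1 muln1 expg1.
by rewrite -[LHS]mulg1 => /mulgI/esym.
Qed.

End ClassTwo.

Section Average.
Variables (R : realType) (G : groupType) (H : hilbert_space R).
Variables (pi : unitary_rep G H) (n : nat).
Hypothesis n_gt0 : (0 < n)%N.
Implicit Types (g h : G) (u v : H).

Lemma rep_real_dot g u v : real_dot (pi g u) (pi g v) = real_dot u v.
Proof. by rewrite /real_dot rep_dot. Qed.

(** The sum runs over exponents, not over the subgroup generated by [g]: once [g ^+ n] is 1, this is
    the projection onto the vectors fixed by [g], whatever the exact order of [g]. *)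
Definition average g v : H := (n%:R^-1)%:C%C *: \sum_(k < n) pi (g ^+ k)%g v.

Lemma average_sub g u v : average g (u - v) = average g u - average g v.
Proof.
rewrite /average -scalerBr -sumrB; congr (_ *: _).
by apply: eq_bigr => k _; rewrite linearB.
Qed.

Lemma average_scale g x v : average g (x *: v) = x *: average g v.
Proof.
rewrite /average scalerA mulrC -scalerA; congr (_ *: _).
by rewrite scaler_sumr; apply: eq_bigr => k _; rewrite linearZ.
Qed.

Lemma average_const (F : 'I_n -> H) u :
  (forall k, F k = u) -> (n%:R^-1)%:C%C *: \sum_k F k = u.
Proof.
move=> Fu; under eq_bigr => k _ do rewrite Fu.
rewrite sumr_const card_ord -(scaler_nat _ u) scalerA fmorphV /= rmorph_nat.
by rewrite mulVf ?scale1r// pnatr_eq0 -lt0n.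
Qed.

Lemma rep_expg g u k : pi g u = u -> pi (g ^+ k)%g u = u.
Proof.
by move=> gu; elim: k => [|k IHk]; rewrite ?rep1// expgS repM IHk.
Qed.

Lemma average_fixed g u : pi g u = u -> average g u = u.
Proof. by move=> gu; apply: average_const => k; apply: rep_expg. Qed.

Lemma average_rep g h v :
  commute g h -> average g (pi h v) = pi h (average g v).
Proof.
move=> gh; rewrite /average linearZ; congr (_ *: _); rewrite linear_sum /=.
by apply: eq_bigr => k _; rewrite -!repM; congr (pi _ v);
  apply/commute_sym/commuteX/commute_sym.
Qed.

Lemma average_comm g h v :
  (forall k, average h (pi (g ^+ k)%g v) = pi (g ^+ k)%g (average h v)) ->
  average g (average h v) = average h (average g v).
Proof.
move=> gh; pose c := (n%:R^-1 : R)%:C%C.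
transitivity (c *: (c *:
  \sum_(k < n) \sum_(j < n) pi (h ^+ j)%g (pi (g ^+ k)%g v))).
  rewrite [LHS]/average; congr (_ *: _); rewrite scaler_sumr.
  by apply: eq_bigr => k _; rewrite -gh.
rewrite exchange_big [RHS]/average; congr (_ *: _); rewrite scaler_sumr.
apply: eq_bigr => j _.
by rewrite [in RHS]/average linearZ /= [in RHS]linear_sum.
Qed.

Variable (g : G).
Hypothesis gn : (g ^+ n)%g = 1%g.

Lemma rep_average v : pi g (average g v) = average g v.
Proof.
rewrite {2}/average linearZ; congr (_ *: _); rewrite linear_sum /=.
under eq_bigr => k _ do rewrite -repM -expgS.
case: n n_gt0 gn => // m _ gm.
by rewrite big_ord_recr big_ord_recl /= gm expg0 addrC.
Qed.

Lemma average_id v : average g (average g v) = average g v.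
Proof. exact/average_fixed/rep_average. Qed.

Lemma average_dot_average u v :
  real_dot (average g u) v = real_dot (average g u) (average g v).
Proof.
have E k : real_dot (average g u) (pi (g ^+ k)%g v) = real_dot (average g u) v.
  by rewrite -[X in real_dot X _](rep_expg k (rep_average u)) rep_real_dot.
rewrite {3}/average real_dotZr real_dot_sumr.
under eq_bigr => k _ do rewrite E.
rewrite sumr_const card_ord -(mulr_natl (real_dot _ _)) mulrA mulVf ?mul1r//.
by rewrite pnatr_eq0 -lt0n.
Qed.

Lemma average_projection : orthogonal_projection (average g).
Proof.
split; [exact: average_sub|exact: average_id|move=> u v].
by rewrite average_dot_average (real_dotC u) (average_dot_average v) real_dotC.
Qed.

End Average.

Section ClassTwoAngle.
Variables (R : realType) (G : groupType) (H : hilbert_space R).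
Variables (pi : unitary_rep G H) (p : nat).
Hypothesis p_pr : prime p.
Variables (a b : G).
Hypotheses (ap : (a ^+ p)%g = 1%g) (bp : (b ^+ p)%g = 1%g).
Local Notation z := [~ a, b]%g.
Hypotheses (za : commute z a) (zb : commute z b).
Implicit Types (u v : H).

Let p_gt0 : (0 < p)%N := prime_gt0 p_pr.
Let zp : (z ^+ p)%g = 1%g := class_two_expg1 (commgC a b) za zb ap.
Let P := average pi p a.
Let P' := average pi p b.
Let Z := average pi p z.
Let HP : orthogonal_projection P := average_projection pi p_gt0 ap.
Let HP' : orthogonal_projection P' := average_projection pi p_gt0 bp.
Let HZ : orthogonal_projection Z := average_projection pi p_gt0 zp.

(** Powers of [a] and [b] commute up to a power of [z], which acts trivially on [u]. *)
Lemma average_commC u : Z u = u -> P (P' u) = P' (P u).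
Proof.
move=> Zu; have zu : pi z u = u by rewrite -Zu; apply: rep_average.
apply: average_comm => i.
rewrite /average linearZ; congr (_ *: _); rewrite linear_sum.
apply: eq_bigr => j _; rewrite -!repM (class_two_expg (commgC a b) za zb).
by rewrite [RHS]repM (rep_expg _ zu).
Qed.

Lemma average_central_comm (h : G) v :
  commute z h -> Z (average pi p h v) = average pi p h (Z v).
Proof.
move=> zh; apply/esym/average_comm => k.
by apply: average_rep; apply: commuteX.
Qed.

(* [pi a] multiplies [w = pi (b ^+ j) (P u)] by the central [pi (z ^+ j)], so
   averaging over [a] makes [P w] invariant under [z ^+ j], hence under [z]. *)
Lemma average_expg_average u j :
  Z u = 0 -> (0 < j < p)%N -> P (pi (b ^+ j)%g (P u)) = 0.
Proof.
move=> Zu /andP[j_gt0 ltjp]; set w := pi (b ^+ j)%g (P u).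
have zjw : pi a w = pi (z ^+ j)%g w.
  rewrite /w -[LHS]repM -[a in LHS]expg1.
  rewrite (class_two_expg (commgC a b) za zb) mul1n expg1.
  have -> : (b ^+ j * a * z ^+ j = z ^+ j * (b ^+ j * a))%g.
    apply/esym/commuteM; last exact/commute_sym/commuteX/commute_sym.
    exact: commuteX2.
  by rewrite !repM rep_average.
have zjPw : pi (z ^+ j)%g (P w) = P w.
  rewrite /P -average_rep; last exact/commuteX/commute_sym.
  by rewrite -zjw average_rep//; exact: rep_average.
have zPw : pi z (P w) = P w.
  have [k l kj _] := egcdnP p j_gt0.
  move: kj; rewrite gcdnC.
  have /eqP-> : coprime p j by rewrite prime_coprime// gtnNdvd.
  move=> kj; have := rep_expg k zjPw.
  by rewrite -expgnA mulnC kj mulnC expgnDr expgnA zp expg1n mul1g.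
have Zw : Z w = 0.
  have -> : Z w = pi (b ^+ j)%g (Z (P u)).
    by apply: average_rep; apply: commuteX.
  by rewrite average_central_comm// Zu -/P (proj0 HP) linear0.
have <- : Z (P w) = P w by apply: average_fixed.
by rewrite average_central_comm// Zw -/P (proj0 HP).
Qed.

(** The left side is the product of P'Pu and Pu, that is, the mean over j of the products of
    [pi (b ^+ j) (P u)] with Pu. Moving P across, every term with j <> 0 vanishes by
    [average_expg_average]. *)
Lemma average_dot_small u : Z u = 0 ->
  real_dot (P' (P u)) (P' (P u)) = p%:R^-1 * real_dot (P u) (P u).
Proof.
move=> Zu; rewrite -(proj_dot_id HP') real_dotC {1}/P' /average real_dotZl.
congr (_ * _); rewrite real_dot_suml.
rewrite (bigD1 (Ordinal p_gt0))//= expg0 rep1 big1 ?addr0// => j j0.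
rewrite -(proj_id HP u) -(proj_dot HP) -/P (proj_id HP).
rewrite average_expg_average ?real_dot0l// ltn_ord andbT lt0n.
by apply: contraNneq j0 => j0; apply/eqP/val_inj.
Qed.

Lemma class_two_angle (c : R) v : 0 < c <= 1 -> p%:R^-1 <= c ^+ 2 ->
  0 <= 2 * real_dot (v - P v) (v - P' v)
       + c * (real_dot (v - P v) (v - P v) + real_dot (v - P' v) (v - P' v)).
Proof.
move=> c01 pc; apply: (proj_angle_split v HP HP' HZ c01).
- by move=> u; apply: average_central_comm.
- by move=> u; apply: average_central_comm.
- exact: average_commC.
- by move=> u Zu; rewrite average_dot_small// ler_wpM2r// real_dot_ge0.
Qed.

End ClassTwoAngle.

(** * A criterion for property (T) *)

Section RealNorm.
Variables (R : realType) (H : hilbert_space R).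
Implicit Types (u v : H) (a : R).

Definition real_norm u : R := Num.sqrt (real_dot u u).

Lemma real_norm_ge0 u : 0 <= real_norm u.
Proof. exact: sqrtr_ge0. Qed.

Lemma sqr_real_norm u : real_norm u ^+ 2 = real_dot u u.
Proof. by rewrite sqr_sqrtr// real_dot_ge0. Qed.

Lemma normE_real_norm u : `|u| = (real_norm u)%:C%C.
Proof. exact: norm_real_dot. Qed.

Lemma real_normD u v : real_norm (u + v) <= real_norm u + real_norm v.
Proof. by rewrite -lecR rmorphD /= -!normE_real_norm ler_normD. Qed.

Lemma real_normN u : real_norm (- u) = real_norm u.
Proof. by rewrite /real_norm real_dotNl real_dotNr opprK. Qed.

Lemma real_norm_le u a :
  0 <= a -> (real_norm u <= a) = (real_dot u u <= a ^+ 2).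
Proof. by move=> a0; rewrite -norm_real_dot_le// normE_real_norm lecR. Qed.

Lemma real_norm_eq0 u : (real_norm u == 0) = (u == 0).
Proof.
by rewrite -(normr_eq0 u) normE_real_norm (inj_eq (@complexI R) _ 0).
Qed.

Variables (l : R).
Hypothesis l01 : 0 <= l < 1.

Lemma geometric_le0 (x K : R) : (forall n, x <= K * l ^+ n) -> x <= 0.
Proof.
move=> xK; have [l0 l1] := andP l01.
apply: (@closed_cvg _ _ \oo _ (geometric K l) [set y | x <= y]).
- exact: closed_ge.
- by apply: nearW => n; apply: xK.
- by apply: cvg_geometric; rewrite ger0_norm.
Qed.

Lemma geometric_lt (K e : R) : 0 < e -> exists n, K * l ^+ n < e.
Proof.
move=> e0; apply: contrapT => /forallNP h.
suff : e <= 0 by rewrite leNgt e0.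
by apply: (@geometric_le0 _ K) => n; rewrite leNgt; apply/negP.
Qed.

Variables (w : nat -> H) (M : R).
Hypothesis M0 : 0 <= M.
Hypothesis w_step : forall n, real_norm (w n.+1 - w n) <= M * l ^+ n.

Lemma geometric_dist n k :
  real_norm (w (n + k)%N - w n) <= M / (1 - l) * l ^+ n.
Proof.
have [l0 l1] := andP l01.
(* The induction on [k] needs the exact partial sum of the geometric series. *)
suff : real_norm (w (n + k)%N - w n) <= M * l ^+ n * (1 - l ^+ k) / (1 - l).
  move=> /le_trans; apply; rewrite [leRHS]mulrAC.
  rewrite ler_wpM2r ?invr_ge0 ?subr_ge0 ?(ltW l1)//.
  by rewrite ler_piMr ?mulr_ge0 ?exprn_ge0// gerBl exprn_ge0.
elim: k => [|k IHk]; first by rewrite addn0 !subrr mulr0 mul0r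
  /real_norm real_dot0l sqrtr0.
rewrite addnS -[w _.+1](subrK (w (n + k)%N)) -addrA.
apply: (le_trans (real_normD _ _)).
apply: (le_trans (lerD (w_step _) IHk)).
rewrite le_eqVlt; apply/orP; left; apply/eqP; rewrite exprD exprS.
by field; rewrite subr_eq0 gt_eqF.
Qed.

Lemma geometric_limit :
  exists u, forall n, real_norm (u - w n) <= M / (1 - l) * l ^+ n.
Proof.
have [l0 l1] := andP l01.
have /cauchy_cvg/cvg_ex[u wu] : cauchy (w @ \oo).
  apply: cauchy_exP => e e0.
  (* Radii of balls lie in [R[i]]; a positive one is real. *)
  have eE : e = (complex.Re e)%:C%C by rewrite RRe_real// gtr0_real.
  have [n nP] : exists n, M / (1 - l) * l ^+ n < complex.Re e.
    by apply: geometric_lt; rewrite -ltcR -eE.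
  exists (w n); exists n => // m /= nm; rewrite -ball_normE /=.
  rewrite -(subnKC nm) distrC normE_real_norm eE ltcR.
  exact: le_lt_trans (geometric_dist _ _) nP.
exists u => n; apply/ler_addgt0Pr => e e0.
have /cvgrPdist_lt/(_ (e%:C)%C) := wu.
rewrite ltcR => /(_ e0)[m _ /(_ (n + m)%N (leq_addl _ _))] /=.
rewrite normE_real_norm ltcR => um.
rewrite -[u](subrK (w (n + m)%N)) -addrA.
apply: (le_trans (real_normD _ _)); rewrite [leRHS]addrC lerD// ?(ltW um)//.
exact: geometric_dist.
Qed.

End RealNorm.

(** * Gradient descent towards invariant vectors *)

Section PropertyT.
Variables (R : realType) (G : groupType) (N p : nat) (g : 'I_N -> G).
Hypotheses (p_pr : prime p) (N_gt0 : (0 < N)%N) (leNp : (N ^ 2 <= p)%N).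
Hypothesis g_order : forall i, (g i ^+ p)%g = 1%g.
Hypothesis g_comml : forall i j, commute [~ g i, g j]%g (g i).
Hypothesis g_commr : forall i j, commute [~ g i, g j]%g (g j).
(** Generation in the form of an induction principle, ready for extending invariance of a vector
    from the generators to [G]. *)
Hypothesis g_gen : forall D : G -> Prop, D 1%g ->
  (forall i x, D x -> D (g i * x)%g) ->
  (forall i x, D x -> D ((g i)^-1 * x)%g) -> forall x, D x.

Let p_gt0 : (0 < p)%N := prime_gt0 p_pr.
(** This number has three roles: it bounds the cosine of the angles, as N^2 <= p; it is the spectral
    gap of [defect_sum]; and it is the step size of the descent. *)
Let c : R := N%:R^-1.

Let N0 : 0 < N%:R :> R. Proof. by rewrite ltr0n. Qed.
Let c0 : 0 < c. Proof. by rewrite invr_gt0. Qed.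
Let c1 : c <= 1. Proof. by rewrite invf_le1// ler1n. Qed.
Let cN : c * N%:R = 1. Proof. by rewrite mulVf// gt_eqF. Qed.

Section Representation.
Variables (H : hilbert_space R) (pi : unitary_rep G H).
Implicit Types (u v : H).

Let P i := average pi p (g i).
Let HP i : orthogonal_projection (P i) :=
  average_projection pi p_gt0 (g_order i).

Definition defect i v : H := v - P i v.
Definition defect_sum v : H := \sum_i defect i v.
Definition energy v : R := \sum_i real_dot (defect i v) (defect i v).

Let HQ i : orthogonal_projection (defect i) := proj_compl (HP i).

Lemma defect_dot_le i v : real_dot (defect i v) (defect i v) <= real_dot v v.
Proof. by rewrite sqr_sub_proj// gerBl real_dot_ge0. Qed.

Lemma energy_ge0 v : 0 <= energy v.
Proof. by apply: sumr_ge0 => i _; apply: real_dot_ge0. Qed.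

Lemma energy_le v : energy v <= N%:R * real_dot v v.
Proof.
rewrite -[N in N%:R]card_ord mulr_natl -sumr_const.
by apply: ler_sum => i _; apply: defect_dot_le.
Qed.

Lemma defect_sum_dot u v :
  real_dot (defect_sum u) v = real_dot u (defect_sum v).
Proof.
rewrite real_dot_suml real_dot_sumr; apply: eq_bigr => i _.
exact: proj_dot (HQ i) u v.
Qed.

Lemma energyE v : energy v = real_dot v (defect_sum v).
Proof.
rewrite real_dot_sumr; apply: eq_bigr => i _.
exact/esym/(proj_dot_id (HQ i)).
Qed.

Lemma defect_sum_le v :
  real_dot (defect_sum v) (defect_sum v) <= N%:R * energy v.
Proof. by have := real_dot_sum_le (defect^~ v); rewrite card_ord. Qed.

Lemma defect_sum_gap v :
  c * energy v <= real_dot (defect_sum v) (defect_sum v).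
Proof.
pose q i := real_dot (defect i v) (defect i v).
have pc : p%:R^-1 <= c ^+ 2.
  by rewrite /c exprVn lef_pV2 ?posrE ?exprn_gt0 ?ltr0n// -natrX ler_nat.
(* The bound is exact on the diagonal. Summed over all pairs it gives (1 + c) E - c N E for the
   energy E, which is c E because c N = 1. *)
have qij i j : (i == j)%:R * ((1 + c) * q i) - c / 2 * (q i + q j)
    <= real_dot (defect i v) (defect j v).
  have [<-|_] := eqVneq i j; first by rewrite mul1r -/(q i); lra.
  have c01 : 0 < c <= 1 by rewrite c0 c1.
  have := class_two_angle pi p_pr (g_order i) (g_order j)
    (@g_comml i j) (@g_commr i j) v c01 pc.
  by rewrite mul0r -/(defect i v) -/(defect j v) -/(q i) -/(q j); lra.
rewrite {2}/defect_sum real_dot_suml.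
apply: (@le_trans _ _ (\sum_i \sum_j
  ((i == j)%:R * ((1 + c) * q i) - c / 2 * (q i + q j)))).
  rewrite le_eqVlt; apply/orP; left; apply/eqP.
  transitivity (\sum_i ((1 + c) * q i - c / 2 * (N%:R * q i + energy v))).
    rewrite sumrB -!mulr_sumr big_split /= -mulr_sumr sumr_const card_ord.
    rewrite -/(energy v) -(mulr_natl (energy v)).
    have -> : c / 2 * (N%:R * energy v + N%:R * energy v)
              = c * N%:R * energy v by field.
    by rewrite cN; ring.
  apply: eq_bigr => i _; rewrite sumrB -mulr_sumr big_split /= sumr_const.
  rewrite card_ord -(mulr_natl (q i)); congr (_ - _).
  rewrite (bigD1 i)//= eqxx mul1r big1 ?addr0// => j ji.
  by rewrite eq_sym (negbTE ji) mul0r.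
apply: ler_sum => i _; rewrite /defect_sum real_dot_sumr.
by apply: ler_sum => j _; apply: qij.
Qed.

Definition descent v : H := v - c%:C%C *: defect_sum v.

Lemma defect_sum_descent v :
  defect_sum (descent v) = defect_sum v - c%:C%C *: defect_sum (defect_sum v).
Proof.
rewrite {1}/defect_sum scaler_sumr -sumrB; apply: eq_bigr => i _.
rewrite /descent (proj_sub (HQ i)); congr (_ - _).
by rewrite /defect scalerBr /P average_scale.
Qed.

(** Write s = Sv with S = [defect_sum]. The new energy is E - 2c |s|^2 + c^2 <s, Ss>. Since S <= N,
    the last term is at most c |s|^2, and the gap gives c |s|^2 >= c^2 E. *)
Lemma energy_descent v : energy (descent v) <= (1 - c ^+ 2) * energy v.
Proof.
rewrite energyE defect_sum_descent /descent.
rewrite !(real_dotBl, real_dotBr, real_dotZl, real_dotZr) -energyE.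
rewrite -(defect_sum_dot v) -energyE.
set s := defect_sum v; set e := energy v.
have := energy_le s; have := defect_sum_gap v; rewrite -/s -/e.
set d := real_dot s s; set f := energy s => gap le_f.
have : c ^+ 2 * f <= c * d.
  rewrite -[c in c * d]mulr1 -cN mulrA -expr2 -mulrA.
  by rewrite ler_wpM2l ?exprn_ge0// ltW.
have : c ^+ 2 * e <= c * d by rewrite expr2 -mulrA ler_wpM2l// ltW.
lra.
Qed.

(** The energy is quadratic, so norms contract by the square root of its rate. *)
Let l : R := Num.sqrt (1 - c ^+ 2).

Lemma energy_iter n v : energy (iter n descent v) <= (l ^+ 2) ^+ n * energy v.
Proof.
have l2 : l ^+ 2 = 1 - c ^+ 2.
  by rewrite sqr_sqrtr// subr_ge0 exprn_ile1// ltW.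
elim: n => [|n IHn]; first by rewrite expr0 mul1r.
rewrite iterS exprS -mulrA; apply: (le_trans (energy_descent _)).
by rewrite -l2 ler_wpM2l// sqr_ge0.
Qed.

Let l01 : 0 <= l < 1.
Proof.
rewrite sqrtr_ge0 -(@ltr_sqr _ _ 1) ?nnegrE ?sqrtr_ge0// expr1n.
by rewrite sqr_sqrtr ?subr_ge0 ?exprn_ile1 ?(ltW c0)// gtrBl exprn_gt0.
Qed.

(** A step from w has squared length c^2 |Sw|^2, at most c^2 N E(w) = c E(w) for the energy E. *)
Lemma descent_step n v :
  real_norm (iter n.+1 descent v - iter n descent v)
    <= Num.sqrt (c * energy v) * l ^+ n.
Proof.
have [l0 l1] := andP l01.
rewrite real_norm_le ?mulr_ge0 ?exprn_ge0 ?sqrtr_ge0//.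
rewrite iterS {1 3}/descent [X in real_dot X _]addrC addKr.
rewrite [X in real_dot _ X]addrC addKr real_dotNl real_dotNr opprK.
rewrite real_dotZl real_dotZr exprMn sqr_sqrtr; last first.
  by rewrite mulr_ge0 ?energy_ge0// ltW.
rewrite -mulrA ler_wpM2l ?(ltW c0)//.
rewrite exprAC [leRHS]mulrC.
apply: le_trans (ler_wpM2l (ltW c0) (defect_sum_le _)) _.
by rewrite mulrA cN mul1r energy_iter.
Qed.

Lemma fixed_of_defect i v : defect i v = 0 -> pi (g i) v = v.
Proof.
move/eqP; rewrite subr_eq0 => /eqP Pv; rewrite {1}Pv.
by rewrite [RHS]Pv; apply: rep_average.
Qed.

Lemma descent_limit v : exists u : H,
  (forall x, pi x u = u) /\
  real_norm (u - v) <= Num.sqrt (c * energy v) / (1 - l).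
Proof.
have [l0 l1] := andP l01; pose K := Num.sqrt (c * energy v) / (1 - l).
have [|u uw] := @geometric_limit _ _ _ l01 (fun n => iter n descent v) _ _
  (descent_step^~ v); first exact: sqrtr_ge0.
exists u; split; last by have := uw 0%N; rewrite expr0 mulr1.
have ug i : pi (g i) u = u.
  apply: fixed_of_defect; apply/eqP; rewrite -real_norm_eq0 eq_le real_norm_ge0.
  (* [K] accounts for the defect of [u - w], as defects do not increase norms, and the square root
     for the defect of the iterate [w] itself. *)
  rewrite andbT; apply: (geometric_le0 l01 (K := K + Num.sqrt (energy v))) => n.
  set w := iter n descent v.
  have -> : defect i u = defect i (u - w) + defect i w.
    by rewrite (proj_sub (HQ i)) subrK.
  apply: (le_trans (real_normD _ _)); rewrite mulrDl lerD//.
    apply: le_trans (uw n); rewrite real_norm_le ?real_norm_ge0//.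
    by rewrite sqr_real_norm defect_dot_le.
  rewrite real_norm_le ?mulr_ge0 ?exprn_ge0 ?sqrtr_ge0// exprMn.
  rewrite sqr_sqrtr ?energy_ge0// exprAC [leRHS]mulrC.
  apply: le_trans (energy_iter n v); rewrite /energy (bigD1 i)//= lerDl.
  by apply: sumr_ge0 => j _; apply: real_dot_ge0.
apply: g_gen => [|i x xu|i x xu]; first exact: rep1.
  by rewrite repM xu.
by rewrite repM xu -{1}(ug i) -repM mulVg rep1.
Qed.

(** The defect is the mean of the vectors v - g_i^k v. This is why the Kazhdan set below consists of
    powers of the generators. *)
Lemma defect_almost_invariant i v (a : R) : 0 <= a ->
  (forall k, (k < p)%N -> `|pi (g i ^+ k)%g v - v| <= a%:C%C) ->
  real_dot (defect i v) (defect i v) <= a ^+ 2.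
Proof.
move=> a0 av; have p0 : p%:R != 0 :> R by rewrite pnatr_eq0 -lt0n.
have -> : defect i v =
    (p%:R^-1)%:C%C *: \sum_(k < p) (v - pi (g i ^+ k)%g v).
  rewrite sumrB scalerBr; congr (_ - _).
  by rewrite (average_const p_gt0 (fun=> erefl)).
rewrite real_dotZl real_dotZr mulrA.
apply: le_trans (ler_wpM2l _ (real_dot_sum_le _)) _.
  by rewrite mulr_ge0 ?invr_ge0.
have : \sum_(k < p) real_dot (v - pi (g i ^+ k)%g v) (v - pi (g i ^+ k)%g v)
    <= p%:R * a ^+ 2.
  rewrite -[p in p%:R]card_ord mulr_natl -sumr_const; apply: ler_sum => k _.
  by rewrite -norm_real_dot_le// distrC av.
rewrite card_ord => /(ler_wpM2l (ler0n R p)).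
move=> /(ler_wpM2l (_ : 0 <= p%:R^-1 * p%:R^-1)).
rewrite mulr_ge0 ?invr_ge0// => /(_ isT)/le_trans; apply.
by rewrite le_eqVlt; apply/orP; left; apply/eqP; field.
Qed.

End Representation.

Theorem property_T_class_two : property_T R G.
Proof.
pose l := Num.sqrt (1 - c ^+ 2).
have l1 : 0 < 1 - l.
  rewrite subr_gt0 -(@ltr_sqr _ _ 1) ?nnegrE ?sqrtr_ge0// expr1n.
  by rewrite sqr_sqrtr ?subr_ge0 ?exprn_ile1 ?(ltW c0)// gtrBl exprn_gt0.
(* The constant is chosen so that the limit of the descent lies within |v| / 2 of [v], hence is
   nonzero. *)
exists [fset (g x.1 ^+ x.2)%g | x : 'I_N * 'I_p in {: 'I_N * 'I_p}]%fset,
  ((1 - l) / 2).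
split=> [|H pi [v v0 vK]]; first by rewrite divr_gt0.
have nv0 : 0 < real_norm v.
  by rewrite lt_neqAle eq_sym real_norm_eq0 v0 real_norm_ge0.
pose a := (1 - l) / 2 * real_norm v.
have a0 : 0 <= a by rewrite mulr_ge0 ?divr_ge0 ?ltW.
have Ev : c * energy pi v <= a ^+ 2.
  rewrite -[leRHS]mul1r -cN -mulrA ler_wpM2l ?(ltW c0)//.
  rewrite -[N in N%:R]card_ord mulr_natl -sumr_const; apply: ler_sum => i _.
  apply: defect_almost_invariant => // k kp.
  rewrite rmorphM /= -normE_real_norm; apply/ltW/vK.
  by apply/imfsetP; exists (i, Ordinal kp).
have [u [ufix uv]] := descent_limit pi v; exists u => //.
apply: contraTneq nv0 => u0; rewrite -leNgt.
move: uv; rewrite u0 sub0r real_normN -/l => uv.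
have : real_norm v <= real_norm v / 2.
  apply: (le_trans uv); rewrite ler_pdivrMr//.
  have -> : real_norm v / 2 * (1 - l) = a by rewrite /a; field.
  by rewrite -(ger0_norm a0) -sqrtr_sqr ler_wsqrtr.
lra.
Qed.

End PropertyT.

(** * Limits of marked finite groups *)

Section MarkedLimit.
Local Open Scope group_scope.
Variables (I : choiceType) (H : nat -> finGroupType) (g : forall m, I -> H m).
Variables (U : set_system nat) (UU : UltraFilter U).

Definition word_eval m (w : seq (I * bool)) : H m :=
  \prod_(a <- w) (if a.2 then (g m a.1)^-1 else g m a.1).

Lemma word_eval_cat m w1 w2 :
  word_eval m (w1 ++ w2) = word_eval m w1 * word_eval m w2.
Proof. by rewrite /word_eval big_cat. Qed.

Definition word_inv (w : seq (I * bool)) := rev [seq (a.1, ~~ a.2) | a <- w].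

Lemma word_eval_inv m w : word_eval m (word_inv w) = (word_eval m w)^-1.
Proof.
elim: w => [|[i b] w IHw]; first by rewrite /word_eval !big_nil invg1.
rewrite /word_inv /= rev_cons -cats1 word_eval_cat IHw /word_eval big_seq1.
by rewrite big_cons invgM /=; case: b; rewrite ?invgK.
Qed.

Definition word_equiv (w1 w2 : seq (I * bool)) : bool :=
  `[< U [set m | word_eval m w1 = word_eval m w2] >].

Lemma word_equiv_refl : reflexive word_equiv.
Proof. by move=> w; apply/asboolP; apply: filterE. Qed.

Lemma word_equiv_sym : symmetric word_equiv.
Proof.
by move=> w1 w2; apply/asboolP/asboolP; apply: filterS => m /= ->.
Qed.

Lemma word_equiv_trans : transitive word_equiv.
Proof.
move=> w2 w1 w3 /asboolP e12 /asboolP e23; apply/asboolP.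
by apply: filterS2 e12 e23 => m /= -> ->.
Qed.

Canonical word_equiv_rel :=
  EquivRel word_equiv word_equiv_refl word_equiv_sym word_equiv_trans.

(** This is the subgroup of the ultraproduct of the [H m] generated by the classes of the families
    [g m i]. *)
Definition marked_limit := {eq_quot word_equiv_rel}%qT.
HB.instance Definition _ := Choice.on marked_limit.

Definition limit_class (w : seq (I * bool)) : marked_limit :=
  \pi_{eq_quot word_equiv_rel}%qT w.

Definition limit_repr (x : marked_limit) : seq (I * bool) :=
  @generic_quotient.repr _ {eq_quot word_equiv_rel}%qT x.

(** At a single [m] this depends on the chosen representative and need not be multiplicative; both
    defects disappear on a set of indices in [U]. *)
Definition limit_val m (x : marked_limit) : H m := word_eval m (limit_repr x).

Lemma limit_classP w1 w2 :
  limit_class w1 = limit_class w2 <->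
  U [set m | word_eval m w1 = word_eval m w2].
Proof.
split=> [/(@eqmodP _ word_equiv_rel)/asboolP//|h].
by apply/(@eqmodP _ word_equiv_rel)/asboolP.
Qed.

Lemma limit_class_repr x : limit_class (limit_repr x) = x.
Proof. exact: reprK. Qed.

Lemma limit_val_class w :
  U [set m | limit_val m (limit_class w) = word_eval m w].
Proof. by apply/limit_classP; rewrite limit_class_repr. Qed.

Lemma limit_valP x y :
  x = y <-> U [set m | limit_val m x = limit_val m y].
Proof. by rewrite -limit_classP !limit_class_repr. Qed.

Definition limit_mul x y := limit_class (limit_repr x ++ limit_repr y).
Definition limit_inv x := limit_class (word_inv (limit_repr x)).
Definition limit_one := limit_class [::].

Lemma limit_val_mul x y :
  U [set m | limit_val m (limit_mul x y) = limit_val m x * limit_val m y].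
Proof.
by apply: filterS (limit_val_class (limit_repr x ++ limit_repr y)) => m /= ->;
  rewrite word_eval_cat.
Qed.

Lemma limit_val_inv x :
  U [set m | limit_val m (limit_inv x) = (limit_val m x)^-1].
Proof.
by apply: filterS (limit_val_class (word_inv (limit_repr x))) => m /= ->;
  rewrite word_eval_inv.
Qed.

Lemma limit_val_one : U [set m | limit_val m limit_one = 1].
Proof.
by apply: filterS (limit_val_class [::]) => m /= ->; rewrite /word_eval big_nil.
Qed.

Fact limit_mulA : associative limit_mul.
Proof.
move=> x y z; apply/limit_valP.
have h1 := limit_val_mul x (limit_mul y z).
have h2 := limit_val_mul y z.
have h3 := limit_val_mul (limit_mul x y) z.
have h4 := limit_val_mul x y.
by apply: filterS2 (filterI h1 h2) (filterI h3 h4) =>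
  m /= [-> ->] [-> ->]; rewrite mulgA.
Qed.

Fact limit_mul1 : left_id limit_one limit_mul.
Proof.
move=> x; apply/limit_valP.
by apply: filterS2 (limit_val_mul limit_one x) limit_val_one => m /= -> ->;
  rewrite mul1g.
Qed.

Fact limit_mulr1 : right_id limit_one limit_mul.
Proof.
move=> x; apply/limit_valP.
by apply: filterS2 (limit_val_mul x limit_one) limit_val_one => m /= -> ->;
  rewrite mulg1.
Qed.

Fact limit_mulV : left_inverse limit_one limit_inv limit_mul.
Proof.
move=> x; apply/limit_valP.
apply: filterS2 (filterI (limit_val_mul (limit_inv x) x) (limit_val_inv x))
  limit_val_one => m /= [-> ->] ->; exact: mulVg.
Qed.

Fact limit_mulrV : right_inverse limit_one limit_inv limit_mul.
Proof.
move=> x; apply/limit_valP.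
apply: filterS2 (filterI (limit_val_mul x (limit_inv x)) (limit_val_inv x))
  limit_val_one => m /= [-> ->] ->; exact: mulgV.
Qed.

HB.instance Definition _ := isGroup.Build marked_limit
  limit_mulA limit_mul1 limit_mulr1 limit_mulV limit_mulrV.

Definition limit_gen i : marked_limit := limit_class [:: (i, false)].

(** Lets relations in the limit be checked in [U]-almost every [H m], on families given by formulas
    instead of words. *)
Definition represents (x : marked_limit) (h : forall m, H m) :=
  U [set m | limit_val m x = h m].

Lemma represents_gen i : represents (limit_gen i) (fun m => g m i).
Proof.
by apply: filterS (limit_val_class [:: (i, false)]) => m /= ->;
  rewrite /word_eval big_seq1.
Qed.

Lemma represents1 : represents 1 (fun=> 1).
Proof. exact: limit_val_one. Qed.

Lemma representsM x y hx hy : represents x hx -> represents y hy ->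
  represents (x * y) (fun m => hx m * hy m).
Proof.
move=> xhx yhy; have xyM := limit_val_mul x y.
by apply: filterS2 xyM (filterI xhx yhy) => m /= -> [-> ->].
Qed.

Lemma representsV x hx :
  represents x hx -> represents x^-1 (fun m => (hx m)^-1).
Proof.
by move=> xhx; apply: filterS2 (limit_val_inv x) xhx => m /= -> ->.
Qed.

Lemma representsX x hx k : represents x hx ->
  represents (x ^+ k) (fun m => hx m ^+ k).
Proof.
move=> xhx; elim: k => [|k IHk]; first exact: represents1.
have := representsM xhx IHk; rewrite -expgS; apply: filterS => m /= ->.
by rewrite expgS.
Qed.

Lemma representsR x y hx hy : represents x hx -> represents y hy ->
  represents [~ x, y] (fun m => [~ hx m, hy m]).
Proof.
move=> xhx yhy; apply: representsM; first exact: representsV.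
by apply: representsM; [apply: representsV|apply: representsM].
Qed.

Lemma represents_eq x y hx hy : represents x hx -> represents y hy ->
  U [set m | hx m = hy m] -> x = y.
Proof.
move=> xhx yhy hxy; apply/limit_valP.
by apply: filterS2 hxy (filterI xhx yhy) => m /= ? [-> ->].
Qed.

Lemma represents_neq x y hx hy : represents x hx -> represents y hy ->
  U [set m | hx m <> hy m] -> x <> y.
Proof.
move=> xhx yhy hxy xy; move: yhy; rewrite -xy => yhy.
by have [m /= [h [hx_m hy_m]]] := filter_ex (filterI hxy (filterI xhx yhy));
  case: h; rewrite -hx_m.
Qed.

Lemma limit_class_prod w :
  limit_class w =
  \prod_(a <- w) (if a.2 then (limit_gen a.1)^-1 else limit_gen a.1).
Proof.
elim: w => [|[i b] w IHw]; first by rewrite big_nil.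
rewrite big_cons -IHw -cat1s.
have -> : (if b then (limit_gen i)^-1 else limit_gen i) =
          limit_class [:: (i, b)].
  case: b => //; apply/limit_valP.
  apply: filterS2
    (filterI (limit_val_class [:: (i, true)]) (limit_val_inv (limit_gen i)))
    (limit_val_class [:: (i, false)]) => m /= [-> ->] ->.
  by rewrite /word_eval !big_seq1.
apply/limit_valP.
apply: filterS2 (filterI (limit_val_class ([:: (i, b)] ++ w))
    (limit_val_mul (limit_class [:: (i, b)]) (limit_class w)))
  (filterI (limit_val_class [:: (i, b)]) (limit_val_class w)) =>
  m /= [e1 e2] [e3 e4].
by rewrite e1 [RHS]e2 e3 e4 -word_eval_cat.
Qed.

Lemma limit_gen_ind (P : marked_limit -> Prop) :
  P 1 -> (forall i x, P x -> P (limit_gen i * x)) ->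
  (forall i x, P x -> P ((limit_gen i)^-1 * x)) -> forall x, P x.
Proof.
move=> P1 PM PV x; rewrite -[x]limit_class_repr limit_class_prod.
elim: (limit_repr x) => [|[i b] w IHw]; first by rewrite big_nil.
by rewrite big_cons; case: b => /=; [apply: PV|apply: PM].
Qed.

End MarkedLimit.

(** * Soficity through regular representations *)

Section Regular.
Local Open Scope group_scope.
Variable K : finGroupType.

(** Multiplication is on the right because permutations compose from left to right. *)
Definition regular_fun (h : K) (i : 'I_#|K|) : 'I_#|K| :=
  enum_rank (enum_val i * h).

Fact regular_fun_inj h : injective (regular_fun h).
Proof. by move=> i j /enum_rank_inj/mulIg/enum_val_inj. Qed.

Definition regular_perm h : 'S_#|K| := perm (@regular_fun_inj h).

Lemma regular_permM h k :
  regular_perm (h * k) = regular_perm h * regular_perm k.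
Proof.
by apply/permP => i; rewrite permM !permE /regular_fun enum_rankK mulgA.
Qed.

Lemma regular_perm1 : regular_perm 1 = 1.
Proof. by apply/permP => i; rewrite !permE /regular_fun mulg1 enum_valK. Qed.

Lemma num_fix_regular h : h != 1 -> num_fix (regular_perm h) = 0%N.
Proof.
move=> h1; apply/eqP/pred0P => i /=; apply/negP => /eqP.
rewrite permE /regular_fun => /(congr1 enum_val); rewrite enum_rankK.
by rewrite -[RHS]mulg1 => /mulgI/eqP; exact/negP.
Qed.

End Regular.

Lemma num_fix1 n : num_fix (1%g : 'S_n) = n.
Proof.
rewrite /num_fix -[RHS]card_ord; apply: eq_card => i.
by rewrite !inE perm1 eqxx.
Qed.

(** Some [m] makes [limit_val m] multiplicative on [F] and nontrivial on its nontrivial elements. In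
    the regular representation of [H m] an element fixes all points or none, so the bounds hold
    without any loss. *)
Lemma marked_limit_sofic (R : realType) (I : choiceType)
    (H : nat -> finGroupType) (g : forall m, I -> H m) (U : set_system nat)
    (UU : UltraFilter U) :
  sofic R (marked_limit g UU).
Proof.
move=> eps F /andP[eps0 eps1].
pose v m (x : marked_limit g UU) : H m := limit_val m x.
(* A filter is closed under the finite intersection indexed by [F]. *)
have allU (P : marked_limit g UU -> set nat) :
    (forall x, U (P x)) -> U [set m | forall x, x \in F -> P x m].
  move=> UP.
  have -> : [set m | forall x, x \in F -> P x m] =
            [set m | forall x, x \in enum_fset F -> P x m] by [].
  elim: (enum_fset F) => [|y s IHs]; first by apply: filterE.
  apply: filterS2 (UP y) IHs => m Py Ps x /=; rewrite inE => /orP[/eqP->//|].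
  exact: Ps.
have UM : U [set m | forall e, e \in F -> forall f, f \in F ->
    v m (e * f)%g = (v m e * v m f)%g].
  by apply: (allU _) => e; apply: (allU _) => f; exact: limit_val_mul.
have UN : U [set m | forall e, e \in F -> e != 1%g -> v m e != 1%g].
  apply: (allU _) => e; have [e1|e1] := eqVneq e 1%g.
    by apply: filterE => m /=.
  (* An ultrafilter contains this set or its complement; the set itself would force [e] to be 1. *)
  case: (in_ultra_setVsetC [set m | v m e = 1%g] UU) => Ue.
    case/eqP: e1; apply/limit_valP.
    by apply: filterS2 Ue (limit_val_one g UU) => m; rewrite /v /= => -> ->.
  by apply: filterS Ue => m /= /eqP.
have [m /= [mM [mN m1]]] := filter_ex
  (filterI UM (filterI UN (limit_val_one g UU : U [set m | v m 1%g = 1%g]))).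
exists #|H m|, (fun x => regular_perm (v m x)); split.
- by apply/card_gt0P; exists 1%g.
- move=> e f eF fF; rewrite mM// regular_permM mulgV num_fix1.
  by rewrite ler_piMl// gerBl ltW.
- by rewrite m1 regular_perm1.
- by move=> e eF e1; rewrite num_fix_regular ?mN// mulr_ge0// ltW.
Qed.

(** * A limit of groups of elementary block matrices *)

Section Elementary.
Variables (F : finComNzRingType) (n : nat).
Local Notation V := {ffun 'I_3 -> 'cV[F]_n}.
Implicit Types (i j k l : 'I_3) (M N : 'M[F]_n) (x : V).

(** Block matrices are encoded by their action on the finite set of block columns, so they live in a
    finite permutation group. For [i = j] the map is the identity, hence always a bijection. *)
Definition elementary_fun i j M x : V :=
  [ffun k => x k + (if (k == i) && (i != j) then M *m x j else 0)].

Lemma elementary_funD i j M N x :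
  elementary_fun i j N (elementary_fun i j M x) = elementary_fun i j (M + N) x.
Proof.
apply/ffunP => k; rewrite !ffunE; have [->|_] /= := eqVneq k i; last first.
  by rewrite addr0.
have [_|ij] /= := eqVneq i j; first by rewrite addr0.
by rewrite addr0 mulmxDl addrA.
Qed.

Lemma elementary_fun0 i j x : elementary_fun i j 0 x = x.
Proof.
by apply/ffunP => k; rewrite !ffunE mul0mx; case: ifP; rewrite addr0.
Qed.

Fact elementary_fun_inj i j M : injective (elementary_fun i j M).
Proof.
apply: (can_inj (g := elementary_fun i j (- M))) => x.
by rewrite elementary_funD subrr elementary_fun0.
Qed.

Definition elementary i j M : {perm V} := perm (@elementary_fun_inj i j M).

Lemma elementaryD i j M N :
  elementary i j (M + N) = (elementary i j M * elementary i j N)%g.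
Proof. by apply/permP => x; rewrite permM !permE elementary_funD. Qed.

Lemma elementary0 i j : elementary i j 0 = 1%g.
Proof. by apply/permP => x; rewrite perm1 permE elementary_fun0. Qed.

Lemma elementaryX i j M m : (elementary i j M ^+ m)%g = elementary i j (M *+ m).
Proof.
elim: m => [|m IHm]; first by rewrite expg0 mulr0n elementary0.
by rewrite expgS IHm mulrS elementaryD.
Qed.

Lemma elementary_comm i j k l M N : j != k -> i != l ->
  commute (elementary i j M) (elementary k l N).
Proof.
move=> jk il; apply/permP => x; rewrite !permM !permE.
apply/ffunP => r; rewrite !ffunE (negbTE jk) (eq_sym l i) (negbTE il) /=.
by rewrite !addr0 -!addrA; congr (_ + _); rewrite addrC.
Qed.

(** The Steinberg relation. The arguments of the commutator are swapped because the left factor of a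
    product of permutations acts first. *)
Lemma elementaryR i j k M N : i != j -> j != k -> i != k ->
  [~ elementary j k N, elementary i j M]%g = elementary i k (M *m N).
Proof.
move=> ij jk ik.
apply: (mulgI (elementary i j M * elementary j k N)%g); rewrite -commgC.
apply/permP => x; rewrite !permM !permE; apply/ffunP => r; rewrite !ffunE.
rewrite ij jk ik !andbT !(eq_sym k) (negbTE jk) (negbTE ik).
rewrite eqxx.
have [->|ri] := eqVneq r i; last first.
  by rewrite !addr0; case: eqP; rewrite ?addr0.
by rewrite (negbTE ij) !addr0 mulmxDr mulmxA addrA.
Qed.

End Elementary.

Section CyclicPositions.
Variables (F : finComNzRingType) (n : nat).
Implicit Types (M N : 'M[F]_n).

(* Indices are modulo 3: these are the positions (0,1), (1,2), (2,0). *)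
Definition cyclic_elementary (r : 'I_3) M := elementary r (r + 1) M.

Lemma cyclic_cases (r r' : 'I_3) : [\/ r' = r, r' = r + 1 | r = r' + 1].
Proof.
by case: r r' => [[|[|[|]]] // ri] [[|[|[|]]] // ri'];
  [apply: Or31|apply: Or32|apply: Or33|apply: Or33|apply: Or31|apply: Or32
  |apply: Or32|apply: Or33|apply: Or31]; apply/val_inj.
Qed.

Lemma cyclic_neq (r : 'I_3) :
  [/\ r != r + 1, r + 1 != r + 1 + 1 & r != r + 1 + 1].
Proof. by case: r => [[|[|[|]]] // ri]; split; apply/eqP => /(congr1 val). Qed.

(** Matrices in the same position commute. Two distinct cyclic positions are consecutive, so their
    commutator sits in a position (s, s+2), which commutes with both. *)
Lemma cyclic_elementary_class_two r r' M N :
  let z := [~ cyclic_elementary r M, cyclic_elementary r' N]%g in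
  commute z (cyclic_elementary r M) /\ commute z (cyclic_elementary r' N).
Proof.
rewrite /cyclic_elementary; have [->|->|->] /= := cyclic_cases r r'.
- have [r1 _ _] := cyclic_neq r.
  have /commgP/eqP-> :
      commute (elementary r (r + 1) M) (elementary r (r + 1) N).
    by apply: elementary_comm; rewrite // eq_sym.
  by split; apply/commute_sym/commute1.
- have [r1 r2 r3] := cyclic_neq r.
  rewrite -invg_comm elementaryR//.
  by split; apply/commute_sym/commuteV/commute_sym; apply: elementary_comm;
    rewrite // eq_sym.
- have [r1 r2 r3] := cyclic_neq r'.
  by rewrite elementaryR//; split; apply: elementary_comm; rewrite // eq_sym.
Qed.

End CyclicPositions.

(** * Shift matrices and matrix units *)

Section Shift.
Variables (F : comNzRingType) (n : nat).

Definition shift_mx : 'M[F]_n := \matrix_(i, j) (i == j.+1 :> nat)%:R.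

(** The matrix unit in row k, column 0. It is zero for k >= n, so the shift recurrence below holds
    for every k. *)
Definition unit_col_mx (k : nat) : 'M[F]_n :=
  \matrix_(i, j) ((i == k :> nat) && (j == 0 :> nat))%:R.

Lemma mul_shift_unit_col k : shift_mx *m unit_col_mx k = unit_col_mx k.+1.
Proof.
apply/matrixP => i j; rewrite !mxE.
have [kn|nk] := ltnP k n.
  rewrite (bigD1 (Ordinal kn))//= !mxE eqxx /= big1 ?addr0 => [|l lk].
    by rewrite -natrM mulnb.
  rewrite !mxE -[l == k :> nat]/(l == Ordinal kn :> nat) val_eqE (negbTE lk).
  by rewrite mulr0.
rewrite big1 => [|l _].
  by rewrite (ltn_eqF (leq_trans (ltn_ord i) (leqW nk))).
by rewrite !mxE (ltn_eqF (leq_trans (ltn_ord l) nk)) mulr0.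
Qed.

Lemma mul_unit_row_col i j :
  (unit_col_mx i)^T *m unit_col_mx j =
  if (i == j) && (i < n)%N then unit_col_mx 0 else 0.
Proof.
apply/matrixP => a b; rewrite !mxE.
under eq_bigr => k _ do rewrite !mxE -natrM mulnb.
case: ifPn => [/andP[/eqP<- ltin]|ij]; last first.
  rewrite mxE big1// => k _.
  have [ki|//] := eqVneq (k : nat) i; have [kj|_] := eqVneq (k : nat) j.
    by move: ij; rewrite -ki -kj eqxx ltn_ord.
  by rewrite andbF.
rewrite mxE (bigD1 (Ordinal ltin))//= eqxx big1 ?addr0// => k ki.
by rewrite -[k == i :> nat]/(k == Ordinal ltin :> nat) val_eqE (negbTE ki).
Qed.

End Shift.

Lemma not_residually_finite_of_duality (G : groupType)
    (u v : nat -> G) (z : G) :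
  z != 1%g -> (forall i, [~ v i, u i]%g = z) ->
  (forall i j, i != j -> [~ v i, u j]%g = 1%g) -> ~ residually_finite G.
Proof.
move=> z1 vu_z vu_1 /(_ z z1)[Q [f /eqP fz]].
have [i [j [ij fij]]] : exists i j, i != j /\ f (u i) = f (u j).
  apply: contrapT => noij.
  have inj : injective (fun k : 'I_#|Q|.+1 => f (u k)).
    move=> k l fkl; apply/val_inj/eqP; apply: contrapT => /negP kl.
    by apply: noij; exists (k : nat), (l : nat).
  by have := leq_card _ inj; rewrite card_ord ltnn.
(* After [f (u i)] is replaced by [f (u j)], the relation v_i u_i = u_i v_i z involves the commuting
   pair v_i, u_j, and [f z] cancels to 1. *)
have := congr1 f (commgC (v i) (u i)); rewrite vu_z !gmulfM fij -!gmulfM.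
have /commgP -> : [~ v i, u j]%g == 1%g by rewrite vu_1.
by rewrite -[LHS]mulg1 [RHS]gmulfM => /mulgI/esym.
Qed.

(** * The sofic group with property (T) that is not residually finite *)

Section SteinbergLimit.
Variables (p : nat) (U : set_system nat) (UU : UltraFilter U).
Hypotheses (p_pr : prime p) (UN : forall k : nat, U [set m | (k <= m)%N]).
Local Notation M m := 'M['F_p]_m.+1.
Local Notation S m := {perm {ffun 'I_3 -> 'cV['F_p]_m.+1}}.

(** The default puts generators 2, 3 and 4 in position (2,0). In [steinberg_mx] the default gives
    generator 4 the matrix unit. *)
Definition steinberg_row (a : 'I_5) : 'I_3 :=
  nth ord_max [:: 0; 1] a.

Definition steinberg_mx m (a : 'I_5) : M m :=
  nth (unit_col_mx _ _ 0) [:: 1%:M; 1%:M; shift_mx _ _; (shift_mx _ _)^T] a.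

Definition steinberg_gen m (a : 'I_5) : S m :=
  cyclic_elementary (steinberg_row a) (steinberg_mx m a).

Definition steinberg_limit : groupType := marked_limit steinberg_gen UU.

Let gen a : steinberg_limit := limit_gen steinberg_gen UU a.

Lemma steinberg_gen_expg a : (gen a ^+ p)%g = 1%g.
Proof.
apply: (represents_eq (representsX p (represents_gen _ UU a))
  (represents1 _ UU)); apply: filterE => m /=.
rewrite /steinberg_gen /cyclic_elementary elementaryX -scaler_nat.
by rewrite pchar_Fp_0// scale0r elementary0.
Qed.

Lemma steinberg_gen_class_two a b :
  commute [~ gen a, gen b]%g (gen a) /\ commute [~ gen a, gen b]%g (gen b).
Proof.
have ra := represents_gen steinberg_gen UU a.
have rb := represents_gen steinberg_gen UU b.
have rab := representsR ra rb.
split; [apply: (represents_eq (representsM rab ra) (representsM ra rab))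
       |apply: (represents_eq (representsM rab rb) (representsM rb rab))];
apply: filterE => m /=;
by have [] := cyclic_elementary_class_two (steinberg_row a) (steinberg_row b)
  (steinberg_mx m a) (steinberg_mx m b).
Qed.

(** A single element of the limit, hence a single word, must produce [A m] for [U]-almost all
    [m]. *)
Definition attained i j (A : forall m, M m) : Prop :=
  exists x : steinberg_limit, represents x (fun m => elementary i j (A m)).

Lemma attainedR i j k A B : attained i j A -> attained j k B ->
  i != j -> j != k -> i != k -> attained i k (fun m => A m *m B m).
Proof.
move=> [x xA] [y yB] ij jk ik; exists [~ y, x]%g.
apply: filterS (representsR yB xA) => m /= ->.
exact: elementaryR.
Qed.

Lemma attained_gen a : attained (steinberg_row a) (steinberg_row a + 1)
  (steinberg_mx^~ a).
Proof. by exists (gen a); apply: represents_gen. Qed.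

Let o0 : 'I_3 := 0.
Let o1 : 'I_3 := 1.
Let o2 : 'I_3 := ord_max.
Let succ0 : o0 + 1 = o1. Proof. exact/val_inj. Qed.
Let succ1 : o1 + 1 = o2. Proof. exact/val_inj. Qed.
Let succ2 : o2 + 1 = o0. Proof. exact/val_inj. Qed.

Let one m : M m := 1%:M.
Let shift m : M m := shift_mx _ _.
Let col k m : M m := unit_col_mx _ _ k.

Let at01 : attained o0 o1 one.
Proof. by have := attained_gen (@Ordinal 5 0 isT); rewrite succ0. Qed.
Let at12 : attained o1 o2 one.
Proof. by have := attained_gen (@Ordinal 5 1 isT); rewrite succ1. Qed.
Let at20 : attained o2 o0 shift.
Proof. by have := attained_gen (@Ordinal 5 2 isT); rewrite succ2. Qed.
Let at20V : attained o2 o0 (fun m => (shift m)^T).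
Proof. by have := attained_gen (@Ordinal 5 3 isT); rewrite succ2. Qed.
Let at20E : attained o2 o0 (col 0).
Proof. by have := attained_gen (@Ordinal 5 4 isT); rewrite succ2. Qed.

Lemma attained_eq i j A B :
  attained i j A -> (forall m, A m = B m) -> attained i j B.
Proof.
by move=> [x xA] AB; exists x; apply: filterS xA => m /= ->; rewrite AB.
Qed.

Lemma attained_mul1l i j k B : attained i j one -> attained j k B ->
  i != j -> j != k -> i != k -> attained i k B.
Proof.
move=> ij1 jkB ij jk ik; apply: attained_eq (attainedR ij1 jkB ij jk ik) _ => m.
exact: mul1mx.
Qed.

Lemma attained_mul1r i j k A : attained i j A -> attained j k one ->
  i != j -> j != k -> i != k -> attained i k A.
Proof.
move=> ijA jk1 ij jk ik; apply: attained_eq (attainedR ijA jk1 ij jk ik) _ => m.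
exact: mulmx1.
Qed.

Let at02 : attained o0 o2 one := attained_mul1l at01 at12 isT isT isT.

(** Commutators with identity blocks move a matrix to another position. The matrix unit goes from
    (2,0) through (2,1) to (0,1); then the row in (0,2) times the transposed shift in (2,1) gives
    the next row in (0,1). *)
Lemma attained_row k : attained o0 o1 (fun m => (col k m)^T).
Proof.
elim: k => [|k IHk].
  have s21 := attained_mul1r at20E at01 isT isT isT.
  apply: attained_eq (attained_mul1l at02 s21 isT isT isT) _.
  by move=> m; apply/matrixP => i j; rewrite !mxE andbC.
have k2 := attained_mul1r IHk at12 isT isT isT.
have s21 := attained_mul1r at20V at01 isT isT isT.
apply: attained_eq (attainedR k2 s21 isT isT isT) _ => m.
by rewrite -trmx_mul mul_shift_unit_col.
Qed.

(** The matrix unit goes from (2,0) through (1,0) to (1,2); then the shift in (1,0) times the column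
    in (0,2) gives the next column in (1,2). *)
Lemma attained_col k : attained o1 o2 (col k).
Proof.
elim: k => [|k IHk].
  have s10 := attained_mul1l at12 at20E isT isT isT.
  exact: attained_mul1r s10 at02 isT isT isT.
have k2 := attained_mul1l at01 IHk isT isT isT.
have s10 := attained_mul1l at12 at20 isT isT isT.
apply: attained_eq (attainedR s10 k2 isT isT isT) _ => m.
exact: mul_shift_unit_col.
Qed.

Lemma elementary_unit_neq1 m : elementary o0 o2 (col 0 m) <> 1%g.
Proof.
(* On the vector whose last block is all ones, block 0 changes from 0 to the first basis vector. *)
move=> /permP/(_ [ffun k => if k == o2 then const_mx 1 else 0])/ffunP/(_ o0).
rewrite permE perm1 !ffunE /= add0r => /matrixP/(_ 0 0).
rewrite !mxE (bigD1 ord0)//= !mxE /= mulr1 big1 ?addr0; last first.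
  move=> j j0; rewrite !mxE /= (_ : j == 0 :> nat = false) ?mul0r//.
  exact/negbTE.
by move/eqP; rewrite oner_eq0.
Qed.

Lemma steinberg_limit_not_residually_finite :
  ~ residually_finite steinberg_limit.
Proof.
have [u uP] := choice attained_row; have [v vP] := choice attained_col.
have vu i j := representsR (vP i) (uP j).
have vuE i j : U [set m | [~ elementary o1 o2 (col i m),
    elementary o0 o1 (col j m)^T]%g =
    if i == j then elementary o0 o2 (col 0 m) else 1%g].
  (* Index [j] exists in blocks of size m+1 only when j <= m; for smaller [m] the row is zero. *)
  apply: filterS (UN j) => m /= jm.
  rewrite elementaryR// mul_unit_row_col ltnS jm andbT eq_sym.
  by case: eqP => // _; rewrite elementary0.
apply: (@not_residually_finite_of_duality _ u v [~ v 0, u 0]%g).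
- apply/eqP; apply: (represents_neq (vu 0 0) (represents1 _ UU)).
  apply: filterS (vuE 0 0) => m /= ->; exact: elementary_unit_neq1.
- move=> i; apply: (represents_eq (vu i i) (vu 0 0)).
  by apply: filterS2 (vuE i i) (vuE 0 0) => m /= -> ->; rewrite eqxx.
- move=> i j ij; apply: (represents_eq (vu i j) (represents1 _ UU)).
  by apply: filterS (vuE i j) => m /= ->; rewrite (negbTE ij).
Qed.

Lemma steinberg_limit_property_T (R : realType) :
  (25 <= p)%N -> property_T R steinberg_limit.
Proof.
move=> p25; apply: (@property_T_class_two R _ 5 p gen) => //.
- exact: steinberg_gen_expg.
- by move=> i j; have [] := steinberg_gen_class_two i j.
- by move=> i j; have [] := steinberg_gen_class_two i j.
- exact: limit_gen_ind.
Qed.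

End SteinbergLimit.

Lemma nonprincipal_ultrafilter : exists2 U : set_system nat, UltraFilter U &
  forall k : nat, U [set m | (k <= m)%N].
Proof.
have [U [UU ooU]] := ultraFilterLemma (_ : ProperFilter \oo).
by exists U => // k; apply: ooU; exists k.
Qed.

Theorem proposition4p5 (R : realType) :
  (forall G : groupType, sofic R G -> property_T R G -> residually_finite G) ->
  exists G : groupType, word_hyperbolic R G /\ ~ residually_finite G.
Proof.
move=> all_rf; have [U UU UN] := nonprincipal_ultrafilter.
(* 29 is the least prime above 25, the square of the number of generators. *)
have p29 : prime 29 by [].
case: (steinberg_limit_not_residually_finite UN (p := 29) (UU := UU)).
apply: all_rf; first exact: marked_limit_sofic.
exact: steinberg_limit_property_T.
Qed.
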